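(* Let $1\le p<\infty$, $\varepsilon\ge n^{-1/\max\{p,2\}}$, and let $\mathcal{O}$ be an arbitrary local oracle for the family $\mathcal{F}$ of convex functions on the $n$-dimensional unit ball $B_p(0,1)=\{x\in\mathbb{R}^n:\|x\|_p\le1\}$ that are Lipschitz-continuous in the $L^p$ norm with Lipschitz constant $1$. Then both the distributional and the high-probability oracle complexity of finding an $\varepsilon$-minimum are $\Omega(1/\varepsilon^{\max\{p,2\}})$. For bounded-error algorithms with error bound $P_e$, the distributional complexity is $\Omega\left((1-P_e)/\varepsilon^{\max\{p,2\}}\right)$, and the high-probability complexity is $\Omega\left(1/\varepsilon^{\max\{p,2\}}\right)$.
   Context: For $f:X\to\mathbb{R}$ with $f^*=\min_X f$, an $\varepsilon$-minimum is a point $x\in X$ with $f(x)<f^*+\varepsilon$. An oracle $\mathcal{O}$ for a family $\mathcal{F}$ of functions on $X$ returns for an instance $f\in\mathcal{F}$ and a query $x\in X$ an answer $\mathcal{O}_f(x)$ (from an arbitrary answer set). It is local if $\mathcal{O}_{f_1}(x)=\mathcal{O}_{f_2}(x)$ whenever $f_1,f_2\in\mathcal{F}$ are equal in a neighborhood of $x$. An algorithm accesses the instance only by adaptive oracle queries; it stops and outputs a point of $X$. $T_A(f,\varepsilon)$ is the number of queries of algorithm $A$ on $f$. With $\Delta(\mathcal{F})$ the set of probability distributions on $\mathcal{F}$ and $\mathcal{A}(\mathcal{O})$ the set of $\mathcal{O}$-based algorithms, the distributional complexity is $\sup_{F\in\Delta(\mathcal{F})}\inf_{A\in\mathcal{A}(\mathcal{O})}\mathbb{E}_F[T_A(F,\varepsilon)]$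 and the high-probability complexity is $\sup_{F\in\Delta(\mathcal{F})}\inf_{A\in\mathcal{A}(\mathcal{O})}\sup\{\tau:\mathbb{P}_F[T_A(F,\varepsilon)\ge\tau]=1-o(1)\}$. For bounded-error algorithms with error bound $P_e$, the output need be an $\varepsilon$-minimum only with probability at least $1-P_e$ (over the random instance and any private randomness), and $1-o(1)$ is replaced by $1-P_e-o(1)$. With $r=\max\{p,2\}$, the asymptotic statements mean: there are a constant $c>0$ (depending at most on $p$) and, for each $n,\varepsilon$, a distribution on $\mathcal{F}$ such that every algorithm with error bound $P_e$ ($P_e=0$ in the error-free case) satisfies $\mathbb{E}[T]\ge c(1-P_e)/\varepsilon^r$, respectively $\mathbb{P}[T\ge c/\varepsilon^r]\ge1-P_e-o(1)$, asymptotically as $1/\varepsilon^r\to\infty$ within the stated range of $\varepsilon$, with $P_e\in[0,1)$ fixed. *)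

(* Defs.v *)
From HB Require Import structures.
From mathcomp Require Import all_boot all_order all_algebra.
From mathcomp Require Import all_classical all_reals all_analysis.
From mathcomp Require Import measurable_realfun.

Set Implicit Arguments.
Unset Strict Implicit.
Unset Printing Implicit Defensive.

Import Order.TTheory GRing.Theory Num.Theory.
Import numFieldNormedType.Exports.

Local Open Scope classical_set_scope.
Local Open Scope ring_scope.

Section Family.
Context {R : realType}.
Implicit Type p : R.

Definition lpnorm p n (x : 'rV[R]_n) : R :=
  (\sum_(i < n) `|x 0 i| `^ p) `^ p^-1.

(* Seen as a type, this set carries the topology induced from R^n, so that
   neighborhoods of its points are relative to the ball. *)
Definition lpball p n : set 'rV[R]_n := [set x | lpnorm p x <= 1].
Arguments lpball : clear implicits.

Definition convex_on_ball p n (f : lpball p n -> R) : Prop :=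
  forall (t : R) (x y z : lpball p n), 0 <= t <= 1 ->
    val z = t *: val x + (1 - t) *: val y ->
    f z <= t * f x + (1 - t) * f y.

Definition lipschitz1_on_ball p n (f : lpball p n -> R) : Prop :=
  forall x y : lpball p n, `|f x - f y| <= lpnorm p (val x - val y).

Record lipschitz_convex p n := LipschitzConvex {
  lc_fun :> lpball p n -> R ;
  lc_convex : convex_on_ball lc_fun ;
  lc_lipschitz : lipschitz1_on_ball lc_fun }.

Lemma convex_cst0 p n : @convex_on_ball p n (fun=> 0).
Proof. by move=> t x y z _ _; rewrite !mulr0 addr0. Qed.

Lemma lipschitz_cst0 p n : @lipschitz1_on_ball p n (fun=> 0).
Proof. by move=> x y; rewrite subr0 normr0 powR_ge0. Qed.

(* The family is equipped with the sigma-algebra of all its subsets. The answers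
   of an oracle are arbitrary, so this is what makes the number of queries of
   every algorithm a random variable under every distribution on the family. *)
HB.instance Definition _ p n := gen_eqMixin (lipschitz_convex p n).
HB.instance Definition _ p n := gen_choiceMixin (lipschitz_convex p n).
HB.instance Definition _ p n := isPointed.Build (lipschitz_convex p n)
  (LipschitzConvex (@convex_cst0 p n) (@lipschitz_cst0 p n)).
HB.instance Definition _ p n := @isMeasurable.Build default_measure_display
  (lipschitz_convex p n) discrete_measurable discrete_measurable0
  discrete_measurableC discrete_measurableU.

Definition eps_minimum p n (f : lipschitz_convex p n) (eps : R)
    (x : lpball p n) : Prop :=
  exists2 x0 : lpball p n, (forall y, f x0 <= f y) & f x < f x0 + eps.

Definition local_oracle p n (Ans : Type)
    (O : lipschitz_convex p n -> lpball p n -> Ans) : Prop :=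
  forall (f1 f2 : lipschitz_convex p n) (x : lpball p n),
    (\forall y \near x, f1 y = f2 y) -> O f1 x = O f2 x.

End Family.
Arguments lpball {R} p n _.
Arguments lipschitz_convex {R} p n.

Section Algorithm.
Variables X Ans : Type.

Variant action := Query of X | Output of X.

(* The next action as a function of the answers received so far; the past
   queries are determined by these answers. *)
Definition algorithm := seq Ans -> action.

(* Answers received in the first k steps when queries are answered by o; the
   sequence is constant once the algorithm has stopped. *)
Fixpoint answers (A : algorithm) (o : X -> Ans) (k : nat) : seq Ans :=
  if k is k'.+1 then
    let h := answers A o k' in
    if A h is Query x then rcons h (o x) else h
  else [::].

(* +oo for a run that never stops. *)
Definition num_queries (R : realType) (A : algorithm) (o : X -> Ans) : \bar R :=
  ereal_sup [set (size (answers A o k))%:R%:E | k in [set: nat]].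

Definition outputs (A : algorithm) (o : X -> Ans) (y : X) : Prop :=
  exists k, A (answers A o k) = Output y.

Record randomized_algorithm (R : realType) := RandomizedAlgorithm {
  seed_display : measure_display ;
  seed : measurableType seed_display ;
  seed_law : probability seed R ;
  strategy : seed -> algorithm }.

End Algorithm.
Arguments num_queries {X Ans} R A o.

Section Complexity.
Context {R : realType} (p : R) (n : nat) (Ans : Type).
Variables (O : lipschitz_convex p n -> lpball p n -> Ans) (eps : R).
Variable P : probability (lipschitz_convex p n) R.
Variable A : randomized_algorithm (lpball p n) Ans R.

Definition run_queries (f : lipschitz_convex p n) (w : seed A) : \bar R :=
  num_queries R (strategy w) (O f).

Definition success (f : lipschitz_convex p n) : set (seed A) :=
  [set w | exists2 y, outputs (strategy w) (O f) y & eps_minimum f eps y].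

Definition measurable_run : Prop :=
  forall f, measurable_fun [set: seed A] (run_queries f) /\
            measurable (success f).

(* The seed is independent of the instance, hence the iterated integrals. *)
Definition error_at_most (Pe : R) : Prop :=
  ((1 - Pe)%:E <= \int[P]_f seed_law A (success f))%E.

Definition mean_queries : \bar R :=
  (\int[P]_f \int[seed_law A]_w run_queries f w)%E.

Definition tail_queries (tau : R) : \bar R :=
  (\int[P]_f seed_law A [set w | tau%:E <= run_queries f w])%E.

End Complexity.

(* Main.v *)
(* The hard instances are [f x = max_j (s_j <u_j, x> - delta_j)], where the [u_j]
   are [M] functionals of norm at most one such that every choice of signs
   admits a point of the ball at which all [s_j <u_j, x>] equal
   [- M ^ (- 1 / max p 2)]: coordinates if [2 <= p], rows of a Hadamard matrix
   otherwise. The signs and the tiny shifts are uniform and independent. With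
   [M] of order [1 / eps ^ max p 2], an [eps]-minimum makes all pieces negative
   and hence reveals all the signs, while a local oracle reveals only the
   active pieces and upper bounds on the others; the random shifts make ties
   between unknown pieces unlikely.
   For a deterministic algorithm, the instances compatible with a history form
   a box, a product of sets of candidate pairs (sign, shift). Give the box the
   weight [prod_j (|F_j| + max(|F_j^+|, |F_j^-|)) / 2]: it bounds the number of
   instances for which one output can be correct, and the weights of the boxes
   into which a query splits a box sum to at most twice its weight. A full
   factor is worth 3/4 of its cardinality, so after [M / 4] queries the fraction
   of instances solved is at most [2 ^ (M / 4) * (3 / 4) ^ M], up to ties. *)

From HB Require Import structures.
Require Import Defs.
From mathcomp Require Import all_boot all_order all_algebra.
From mathcomp Require Import zify ring.
Set Implicit Arguments.
Unset Strict Implicit.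
Unset Printing Implicit Defensive.

Import Order.TTheory GRing.Theory Num.Theory.

(** * Counting the instances solved with few queries *)

Section Replies.
Variables X Ans : Type.

(** [t] counts the queries still allowed. Starting from any history [h] lets an induction on [t]
    walk down the decision tree. *)
Fixpoint output_within (A : algorithm X Ans) (o : X -> Ans) (t : nat)
    (h : seq Ans) : option X :=
  match A h with
  | Output y => Some y
  | Query x => if t is t'.+1 then output_within A o t' (rcons h (o x)) else None
  end.

End Replies.

Section Boxes.
Variables (J S : finType) (sgn : S -> bool).
Implicit Types (C : {set S}) (F : J -> {set S}).

Definition box F : {set {ffun J -> S}} := [set th in family F].

Lemma in_box F th : (th \in box F) = [forall j, th j \in F j].
Proof. by rewrite inE; apply/familyP/forallP. Qed.

Lemma card_box F : #|box F| = \prod_j #|F j|.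
Proof. by rewrite cardsE card_family foldrE big_image. Qed.

(** Twice the factor of the box weight, to stay in the naturals; hence the factors [2 ^ #|J|]
    below. *)
Definition weight C :=
  #|C| + maxn #|[set c in C | sgn c]| #|[set c in C | ~~ sgn c]|.

(* Multiplied by 2, this bounds the instances of the box having, at a given
   query, an undetermined coordinate tied with another active one. *)
Definition tie_weight F := \sum_(j | 1 < #|F j|) \prod_(k | k != j) #|F k|.

Lemma weightS C C' : C \subset C' -> weight C <= weight C'.
Proof.
move=> sCC'; have sub (P : pred S) :
    #|[set c in C | P c]| <= #|[set c in C' | P c]|.
  by apply/subset_leq_card/subsetP=> c /[!inE] /andP[/(subsetP sCC')-> ->].
by rewrite leq_add ?subset_leq_card// geq_max !leq_max !sub ?orbT.
Qed.

Lemma weightD1 C c : c \in C -> (weight (C :\ c)).+1 <= weight C.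
Proof.
move=> cC; rewrite /weight (cardsD1 c C) cC add1n addSn ltnS leq_add2l.
have sub (P : pred S) : #|[set x in C :\ c | P x]| <= #|[set x in C | P x]|.
  by apply/subset_leq_card/subsetP=> d /[!inE] /andP[/andP[_ ->] ->].
by rewrite geq_max !leq_max !sub ?orbT.
Qed.

Lemma weight_set1 c : weight [set c] = 2.
Proof.
rewrite /weight cards1; case sc: (sgn c).
  rewrite (_ : [set _ in _ | sgn _] = [set c]) ?cards1; last first.
    by apply/setP=> d; rewrite !inE; case: eqP => // ->.
  rewrite (_ : [set _ in _ | ~~ _] = set0) ?cards0//.
  by apply/setP=> d; rewrite !inE; case: eqP => // ->; rewrite sc.
rewrite (_ : [set _ in _ | ~~ sgn _] = [set c]) ?cards1; last first.
  by apply/setP=> d; rewrite !inE; case: eqP => // ->; rewrite sc.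
rewrite (_ : [set _ in _ | sgn _] = set0) ?cards0//.
by apply/setP=> d; rewrite !inE; case: eqP => // ->; rewrite sc.
Qed.

Lemma double_card_sign C b : 2 * #|[set c in C | sgn c == b]| <= weight C.
Proof.
rewrite mul2n -addnn leq_add//.
  by apply/subset_leq_card/subsetP=> c /[!inE] /andP[].
rewrite leq_max; case: b.
  by rewrite subset_leq_card//; apply/subsetP => c; rewrite !inE eqb_id.
by rewrite orbC subset_leq_card//; apply/subsetP => c; rewrite !inE eqbF_neg.
Qed.

(** Fixing all signs leaves a sub-box, each factor of which has at most half the weight of the
    original factor. *)
Lemma card_box_sign F (b : J -> bool) :
  2 ^ #|J| * #|[set th in box F | [forall j, sgn (th j) == b j]]|
    <= \prod_j weight (F j).
Proof.
rewrite (_ : [set _ in _ | _] = box (fun j => [set c in F j | sgn c == b j])).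
  rewrite card_box -prod_nat_const -big_split/=.
  by apply: leq_prod => j _; exact: double_card_sign.
apply/setP => th; rewrite inE !in_box.
apply/andP/forallP => [[/forallP H1 /forallP H2] j|H].
  by rewrite inE H1 H2.
by split; apply/forallP => j; have := H j; rewrite inE => /andP[].
Qed.

End Boxes.

(** * Peeling the largest candidate off a box *)

Section Peeling.
Variables (J S : finType) (sgn : S -> bool).
Variables (disp : Order.disp_t) (V : orderType disp).
Variables (phi : J -> S -> V) (F : J -> {set S}) (i : J) (c : S).
Hypothesis cF : c \in F i.
Hypothesis top : forall j d, d \in F j -> (phi j d <= phi i c)%O.
Hypothesis phi_inj : forall j d d',
  sgn d = sgn d' -> phi j d = phi j d' -> d = d'.

Let v := phi i c.

Definition without_top j := if j == i then F i :\ c else F j.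

(* Determined coordinates are kept even when they tie with the top one: such a
   tie reveals nothing, but the algorithm can provoke it at will. *)
Definition below_top j :=
  if j == i then [set c] else
  if #|F j| <= 1 then F j else [set d in F j | (phi j d < v)%O].

Definition tied_top j k :=
  if k == i then [set c] else
  if k == j then [set d in F j | phi j d == v] else F k.

(** The cases depend on whether the instance takes [c] at [i]. If not, it is peeled further; if so,
    the answer is settled unless an undetermined coordinate ties at [v], and such instances are
    merely counted. *)
Lemma peel_cover th : th \in box F ->
  [|| th \in box without_top, th \in box below_top |
    [exists j, [&& j != i, 1 < #|F j| & th \in box (tied_top j)]]].
Proof.
rewrite !in_box => /forallP thF.
have [thi|thi] := eqVneq (th i) c; last first.
  apply/orP; left; apply/forallP => j; rewrite /without_top.
  by case: eqP => [->|_]; rewrite ?inE ?thi thF.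
apply/orP; right; rewrite -[X in X || _]negbK -implybE; apply/implyP.
rewrite negb_forall => /existsP[j]; rewrite /below_top.
case: eqP => [->|/eqP ji]; first by rewrite inE thi eqxx.
case: leqP => [_|F1]; first by rewrite thF.
rewrite inE thF/= -leNgt => vj.
apply/existsP; exists j; rewrite ji F1/= in_box; apply/forallP => k.
rewrite /tied_top; case: eqP => [->|_]; first by rewrite thi inE.
case: eqP => [->|_]; last exact: thF.
by rewrite inE thF/= eq_le vj top ?thF.
Qed.

(** By [phi_inj], at most one candidate of each sign has value [v] at [j]. *)
Lemma card_tied_top j : j != i ->
  #|box (tied_top j)| <= 2 * \prod_(k | (k != i) && (k != j)) #|F k|.
Proof.
move=> ji; rewrite card_box (bigD1 i)//= {1}/tied_top eqxx cards1 mul1n.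
rewrite (bigD1 j)//= {1}/tied_top (negbTE ji) eqxx leq_mul//.
  set T := [set d in _ | _].
  have inj : {in T &, injective sgn}.
    move=> d d' /[!inE] /andP[_ /eqP dv] /andP[_ /eqP dv'] dd'.
    by apply: (phi_inj (j := j) dd'); rewrite dv dv'.
  by rewrite -(card_in_imset inj) (leq_trans (max_card _))// card_bool.
by apply: leq_prod => k /andP[/negbTE ki /negbTE kj]; rewrite /tied_top ki kj.
Qed.

Let E := \sum_(j | (j != i) && (1 < #|F j|))
  \prod_(k | (k != i) && (k != j)) #|F k|.

Lemma tie_weight_below_top : tie_weight below_top <= E.
Proof.
rewrite /tie_weight /E big_mkcond [leqRHS]big_mkcond /=.
apply: leq_sum => j _; case: ifP => // F1.
have ji : j != i by apply: contraTneq F1 => ->; rewrite /below_top eqxx cards1.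
have sub k : k != i -> #|below_top k| <= #|F k|.
  rewrite /below_top => /negbTE ->; case: ifP => // _.
  by apply/subset_leq_card/subsetP => d /[!inE] /andP[].
rewrite ji (leq_trans F1 (sub _ ji))/= (bigD1 i) 1?eq_sym//=.
rewrite {1}/below_top eqxx cards1 mul1n.
rewrite (eq_bigl (fun k => (k != i) && (k != j))); last by move=> k; rewrite andbC.
by apply: leq_prod => k /andP[ki _]; exact: sub.
Qed.

(** Every term with [j != i] contains the factor [#|F i|], which drops by one and frees the matching
    term of [E]. The decrease of [tie_weight] thus pays for the ties. *)
Lemma tie_weight_without_top : tie_weight without_top + E <= tie_weight F.
Proof.
pose a j := \prod_(k | (k != i) && (k != j)) #|F k|.
have prodE (G : J -> {set S}) j : j != i ->
    \prod_(k | k != j) #|G k| =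
    #|G i| * \prod_(k | (k != i) && (k != j)) #|G k|.
  move=> ji; rewrite (bigD1 i) 1?eq_sym//=; congr (_ * _).
  by apply: eq_bigl => k; rewrite andbC.
have woE j : j != i -> without_top j = F j by rewrite /without_top => /negbTE ->.
have split (G : J -> {set S}) : tie_weight G =
    (1 < #|G i|) * \prod_(k | k != i) #|G k| +
    \sum_(j | (j != i) && (1 < #|G j|)) \prod_(k | k != j) #|G k|.
  rewrite /tie_weight big_mkcond (bigD1 i)//=; congr (_ + _).
    by case: ifP; rewrite ?mul1n ?mul0n.
  by rewrite big_mkcondr.
rewrite !split -addnA leq_add//.
  rewrite (eq_bigr (fun k => #|F k|)); last by move=> k ki; rewrite woE.
  rewrite leq_mul2r; apply/orP; right.
  have : #|without_top i| <= #|F i|.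
    by rewrite /without_top eqxx subset_leq_card ?subsetDl.
  by case: leqP => // h1 h2; rewrite (leq_trans h1 h2).
rewrite (eq_bigl (fun j => (j != i) && (1 < #|F j|))); last first.
  by move=> j; case: (eqVneq j i) => //= ji; rewrite woE.
rewrite (eq_bigr (fun j => #|without_top i| * a j)); last first.
  move=> j /andP[ji _]; rewrite prodE//; congr (_ * _).
  by apply: eq_bigr => k /andP[ki _]; rewrite woE.
rewrite [leqRHS](eq_bigr (fun j => #|F i| * a j)); last first.
  by move=> j /andP[ji _]; rewrite prodE.
rewrite -!big_distrr/= -mulSnr leq_mul2r; apply/orP; right.
by rewrite /without_top eqxx (cardsD1 c (F i)) cF.
Qed.

Let P := \prod_(j | j != i) weight sgn (F j).

Lemma weight_below_top : \prod_j weight sgn (below_top j) <= 2 * P.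
Proof.
rewrite (bigD1 i)//= {1}/below_top eqxx weight_set1 leq_mul2l/=.
apply: leq_prod => j /negbTE ji; apply: weightS; rewrite /below_top ji.
by case: ifP => // _; apply/subsetP => d /[!inE] /andP[].
Qed.

(** The factor at [i] drops by at least one, which frees [P]. As [below_top] weighs at most [2 * P],
    all boxes peeled off at one query together weigh at most twice the initial box. *)
Lemma weight_without_top :
  \prod_j weight sgn (without_top j) + P <= \prod_j weight sgn (F j).
Proof.
rewrite (bigD1 i)//= [leqRHS](bigD1 i)//= -/P.
rewrite (_ : \prod_(j | _) _ = P); last first.
  by apply: eq_bigr => j /negbTE ji; rewrite /without_top ji.
by rewrite -mulSnr leq_mul2r {1}/without_top eqxx weightD1// orbT.
Qed.

Lemma peel_count (Q : {set {ffun J -> S}}) :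
  #|Q :&: box F| <=
    #|Q :&: box without_top| + #|Q :&: box below_top| + 2 * E.
Proof.
pose T := \bigcup_(j | (j != i) && (1 < #|F j|)) box (tied_top j).
have TE : #|T| <= 2 * E.
  rewrite /E big_distrr/= /T.
  apply: (@leq_trans (\sum_(j | (j != i) && (1 < #|F j|)) #|box (tied_top j)|)).
    elim/big_rec2: _ => [|j m B _ IH]; first by rewrite cards0.
    by rewrite (leq_trans (leq_card_setU _ _))// leq_add2l.
  by apply: leq_sum => j /andP[ji _]; exact: card_tied_top.
have sub : Q :&: box F \subset
    (Q :&: box without_top) :|: (Q :&: box below_top) :|: T.
  apply/subsetP => th; rewrite in_setI => /andP[thQ /peel_cover].
  rewrite !in_setU !in_setI thQ/= -orbA => /or3P[->//|->|/existsP[j]].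
    by rewrite orbT.
  move=> /and3P[ji Fj thj]; apply/orP; right; apply/orP; right.
  by apply/bigcupP; exists j; rewrite // ji.
apply: leq_trans (subset_leq_card sub) _.
apply: leq_trans (leq_card_setU _ _) _; rewrite leq_add//.
exact: leq_card_setU.
Qed.

(* [N], [N1] and [N'] stand for the number of successful instances in [F],
   [below_top] and [without_top]. *)
Lemma peel_bound t (N N1 N' : nat) :
  N <= N' + N1 + 2 * E ->
  2 ^ #|J| * N1 <= 2 ^ t * \prod_j weight sgn (below_top j)
                   + 2 ^ #|J| * (2 * t) * tie_weight below_top ->
  2 ^ #|J| * N' <= 2 ^ t.+1 * \prod_j weight sgn (without_top j)
                   + 2 ^ #|J| * (2 * t.+1) * tie_weight without_top ->
  2 ^ #|J| * N <= 2 ^ t.+1 * \prod_j weight sgn (F j)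
                  + 2 ^ #|J| * (2 * t.+1) * tie_weight F.
Proof.
have := weight_below_top; have := weight_without_top.
have := tie_weight_below_top; have := tie_weight_without_top.
move: (tie_weight F) (tie_weight without_top) (tie_weight below_top) E P.
move: (\prod_j weight sgn (F j)) (\prod_j weight sgn (without_top j)).
move: (\prod_j weight sgn (below_top j)) (2 ^ #|J|).
rewrite expnS; move: (2 ^ t) => e W1 x W W' D D' D1 E0 P0 hD' hD1 hW' hW1 hN h1 h'.
have hN2 : x * N <= x * N' + x * N1 + x * (2 * E0) by nia.
have hx1 : e * W1 <= e * (2 * P0) by rewrite leq_mul2l hW1 orbT.
have hx2 : e * (W' + P0) <= e * W by rewrite leq_mul2l hW' orbT.
have hx3 : x * (2 * t) * D1 <= x * (2 * t) * E0 by rewrite leq_mul2l hD1 orbT.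
have hx4 : x * (2 * t.+1) * (D' + E0) <= x * (2 * t.+1) * D.
  by rewrite leq_mul2l hD' orbT.
(* The tie allowance for [t.+1] queries splits into [2 * t] for the later queries on [below_top] and
   2 for the present one. *)
have e1 : x * (2 * t.+1) * (D' + E0)
    = x * (2 * t.+1) * D' + x * (2 * t) * E0 + x * (2 * E0) by ring.
have e2 : 2 * e * W' + e * (2 * P0) = 2 * (e * (W' + P0)) by ring.
have e3 : 2 * e * W = 2 * (e * W) by ring.
lia.
Qed.

End Peeling.

(** * Query algorithms against boxes of instances *)

Section Game.
Variables (J S : finType) (sgn : S -> bool) (X Ans : Type).
Variables (disp : Order.disp_t) (V : orderType disp) (phi : X -> J -> S -> V).
Variables (o : {ffun J -> S} -> X -> Ans) (win : {ffun J -> S} -> X -> bool).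
Hypothesis phi_inj : forall x j d d',
  sgn d = sgn d' -> phi x j d = phi x j d' -> d = d'.
(** This is what locality gives for maxima of pieces: near [x], pieces strictly below the shared
    piece [i] cannot influence the maximum. *)
Hypothesis o_local : forall (th th' : {ffun J -> S}) x i, th i = th' i ->
  (forall j, th j = th' j \/
     (phi x j (th j) < phi x i (th i))%O /\
     (phi x j (th' j) < phi x i (th i))%O) ->
  o th x = o th' x.
Hypothesis win_sign : forall y, exists b : J -> bool,
  forall th, win th y -> forall j, sgn (th j) = b j.
Variables (A : algorithm X Ans) (j0 : J).

Definition winners t h : {set {ffun J -> S}} :=
  [set th | if output_within A (o th) t h is Some y then win th y else false].

Lemma winners_output t h y F : A h = Output y ->
  2 ^ #|J| * #|winners t h :&: box F| <= \prod_j weight sgn (F j).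
Proof.
move=> Ah; have [b hb] := win_sign y.
apply: leq_trans (card_box_sign sgn F b); rewrite leq_mul2l; apply/orP; right.
apply/subset_leq_card/subsetP => th; rewrite !inE => /andP[+ ->] /=.
have -> : output_within A (o th) t h = Some y by case: t => [|t] /=; rewrite Ah.
by move=> /hb hs; apply/forallP => j; apply/eqP.
Qed.

(** All instances of this box share the piece [(i, c)], and their other coordinates are either
    determined, hence equal, or strictly lower; [o_local] yields a common answer. *)
Lemma winners_query t h x F i c : A h = Query x -> exists a,
  winners t.+1 h :&: box (below_top (phi x) F i c)
    = winners t (rcons h a) :&: box (below_top (phi x) F i c).
Proof.
move=> Ah; set B := box _; have [B0|[th0 th0B]] := set_0Vmem B.
  (* For an empty box any answer will do; the oracle supplies one. *)
  exists (o [ffun=> c] x); by rewrite B0 !setI0.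
exists (o th0 x); apply/setP => th; rewrite !in_setI andbC [RHS]andbC.
have [thB|//] := boolP (th \in B); rewrite /= !inE /= Ah.
suff -> : o th x = o th0 x by [].
move: th0B thB; rewrite /B !in_box => /forallP th0B /forallP thB.
have := th0B i; have := thB i; rewrite /below_top eqxx !inE => /eqP thi /eqP th0i.
apply: (o_local (i := i)); first by rewrite thi.
move=> j; have := th0B j; have := thB j; rewrite /below_top.
case: eqP => [-> _ _|_]; first by left; rewrite thi.
case: ifP => [/card_le1_eqP F1 h1 h2|_]; first by left; exact: F1.
by rewrite !inE thi => /andP[_ ?] /andP[_ ?]; right.
Qed.

(** The outer induction is on the budget, the inner one on the number of candidates: at a fixed
    query the top candidate is peeled off repeatedly, and each [below_top] continues with its answer
    and one query less. *)
Theorem winners_bound t h F :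
  2 ^ #|J| * #|winners t h :&: box F|
    <= 2 ^ t * \prod_j weight sgn (F j) + 2 ^ #|J| * (2 * t) * tie_weight F.
Proof.
elim: t h F => [|t IHt] h F.
  case Ah: (A h) => [x|y]; last first.
    by rewrite expn0 mul1n (leq_trans (winners_output _ _ Ah))// leq_addr.
  rewrite (_ : _ :&: _ = set0) ?cards0 ?muln0//.
  by apply/setP => th; rewrite !inE /= Ah.
case Ah: (A h) => [x|y]; last first.
  rewrite (leq_trans (winners_output _ _ Ah))// (leq_trans _ (leq_addr _ _))//.
  by rewrite leq_pmull// expn_gt0.
have [n] := ubnP (\sum_j #|F j|); elim: n F => // n IHn F.
rewrite ltnS => Fn.
case: (pickP [pred q : J * S | q.2 \in F q.1]) => [q0 q0F|F0]; last first.
  rewrite (_ : _ :&: _ = set0) ?cards0 ?muln0//.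
  apply/setP => th; rewrite in_setI in_box in_set0.
  by apply/negbTE/negP => /andP[_ /forallP/(_ j0)]; have /= -> := F0 (j0, th j0).
case: (@Order.TotalTheory.arg_maxP _ _ _ q0
  [pred q : J * S | q.2 \in F q.1] (fun q => phi x q.1 q.2) q0F).
move=> [i c] /= cF top.
have topF j d : d \in F j -> (phi x j d <= phi x i c)%O by move=> /(top (j, d)).
have [a ha] := winners_query t F i c Ah.
have hN := peel_count topF (@phi_inj x) (winners t.+1 h).
apply: (peel_bound cF hN).
  by rewrite ha.
apply: IHn; apply: leq_trans Fn.
rewrite (bigD1 i)//= [ltnRHS](bigD1 i)//= /without_top eqxx.
rewrite (cardsD1 c (F i)) cF addSn ltnS leq_add2l.
by apply: leq_sum => j /negbTE ->.
Qed.

End Game.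

Section FullBox.
Variables (J : finType) (L : nat).
Notation S := (bool * 'I_L)%type.

Lemma weight_setT : weight fst [set: S] = 3 * L.
Proof.
have card_sgn b : #|[set c in [set: S] | c.1 == b]| = L.
  rewrite (_ : [set _ in _ | _] = setX [set b] setT); last first.
    by apply/setP => -[b' k]; rewrite !inE andbT.
  by rewrite cardsX cards1 cardsT card_ord mul1n.
rewrite /weight cardsT card_prod card_bool card_ord.
have -> : [set c in [set: S] | c.1] = [set c in [set: S] | c.1 == true].
  by apply/setP => c; rewrite !inE eqb_id.
have -> : [set c in [set: S] | ~~ c.1] = [set c in [set: S] | c.1 == false].
  by apply/setP => c; rewrite !inE eqbF_neg.
by rewrite !card_sgn maxnn; lia.
Qed.

Lemma tie_weight_setT :
  tie_weight (fun _ : J => [set: S]) <= #|J| * (2 * L) ^ #|J|.-1.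
Proof.
rewrite /tie_weight -sum_nat_const big_mkcond; apply: leq_sum => j _.
rewrite cardsT card_prod card_bool card_ord; case: ifP => // _.
rewrite prod_nat_const (_ : #|_| = #|J|.-1)//.
by rewrite -(cardC1 j); apply: eq_card => k; rewrite !inE.
Qed.

End FullBox.

(** Up to common factors, [162 = 2 * 3 ^ 4] comes from the weight after [m] queries and
    [256 = 4 ^ 4] from the number of instances. *)
Lemma muln_expn_162_256 m : m * 162 ^ m <= 2 * 256 ^ m.
Proof.
case: m => [|m] //; elim: m => // m IH.
(* The step needs [(m + 1) / m * 162 <= 256], which fails at 1 and holds from 2 on; exponent 2 is
   computed. *)
case: m IH => [_|m IH]; first by [].
rewrite expnS [256 ^ _]expnS; move: IH.
move: (162 ^ _) (256 ^ _) => a b; nia.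
Qed.

(* The weights of the full box leave at most the fraction
   [2 ^ m * (3 / 4) ^ (4 * m)] of winners, up to the loss due to ties. *)
Lemma winners_fraction m L w : 0 < m -> L = 4 * m ^ 3 ->
  2 ^ (4 * m) * w <= 2 ^ m * (3 * L) ^ (4 * m)
    + 2 ^ (4 * m) * (2 * m) * (4 * m * (2 * L) ^ (4 * m).-1) ->
  m * w <= 3 * (2 * L) ^ (4 * m).
Proof.
move=> m0 LE h; have L0 : 0 < L by rewrite LE muln_gt0/= expn_gt0 m0.
have NE : (2 * L) ^ (4 * m) = 2 * L * (2 * L) ^ (4 * m).-1.
  by rewrite -expnS prednK// muln_gt0.
(* [L] is chosen so that [8 * m ^ 3 = 2 * L]: ties cost the fraction [1 / m] of all instances. *)
have ties : m * ((2 * m) * (4 * m * (2 * L) ^ (4 * m).-1)) = (2 * L) ^ (4 * m).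
  by rewrite NE; move: (_ ^ _.-1) => e; rewrite LE; ring.
have pow : m * (2 ^ m * (3 * L) ^ (4 * m))
    <= 2 ^ (4 * m) * (2 * (2 * L) ^ (4 * m)).
  have -> : m * (2 ^ m * (3 * L) ^ (4 * m)) = m * 162 ^ m * L ^ (4 * m).
    by rewrite expnMn (_ : 162 = 2 * 3 ^ 4)// [in RHS]expnMn -expnM; ring.
  have -> : 2 ^ (4 * m) * (2 * (2 * L) ^ (4 * m)) = 2 * 256 ^ m * L ^ (4 * m).
    rewrite expnMn (_ : 256 = 2 ^ 4 * 2 ^ 4)// [in RHS]expnMn -expnM; ring.
  by rewrite leq_mul2r muln_expn_162_256 orbT.
have x0 : 0 < 2 ^ (4 * m) by rewrite expn_gt0.
rewrite -(leq_pmul2l x0); move: h pow ties; clear NE.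
move: (2 ^ (4 * m)) ((2 * L) ^ (4 * m)) (2 ^ m * (3 * L) ^ (4 * m)).
move: (4 * m * _) => T x N Y h pow ties.
have h1 : m * (x * w) <= m * (Y + x * (2 * m) * T) by rewrite leq_mul2l h orbT.
have e1 : m * (Y + x * (2 * m) * T) = m * Y + x * (m * (2 * m * T)) by ring.
rewrite e1 ties in h1.
have e2 : x * (m * w) = m * (x * w) by ring.
have e3 : x * (3 * N) = x * (2 * N) + x * N by ring.
lia.
Qed.

Section FewWinners.
Variables (m L : nat) (X Ans : Type).
Notation S := (bool * 'I_L)%type.
Notation J := 'I_(4 * m).
Variables (disp : Order.disp_t) (V : orderType disp) (phi : X -> J -> S -> V).
Variables (o : {ffun J -> S} -> X -> Ans) (win : {ffun J -> S} -> X -> bool).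
Hypothesis m0 : 0 < m.
Hypothesis LE : L = 4 * m ^ 3.
Hypothesis phi_inj : forall x j (d d' : S),
  d.1 = d'.1 -> phi x j d = phi x j d' -> d = d'.
Hypothesis o_local : forall (th th' : {ffun J -> S}) x i, th i = th' i ->
  (forall j, th j = th' j \/
     (phi x j (th j) < phi x i (th i))%O /\
     (phi x j (th' j) < phi x i (th i))%O) ->
  o th x = o th' x.
Hypothesis win_sign : forall y, exists b : J -> bool,
  forall th, win th y -> forall j, (th j).1 = b j.

(** Of the fraction [3 / m], the weights contribute [2 / m] and the ties [1 / m]; it becomes the
    [o(1)] term. *)
Theorem few_winners (A : algorithm X Ans) :
  m * #|[set th | if output_within A (o th) m [::] is Some y
                  then win th y else false]| <= 3 * #|{: {ffun J -> S}}|.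
Proof.
have j0 : J by apply: (@Ordinal _ 0); rewrite muln_gt0.
have := winners_bound phi_inj o_local win_sign A j0 m [::]
  (fun=> [set: bool * 'I_L]).
rewrite (_ : _ :&: _ = winners o win A m [::]); last first.
  apply/setP => th; rewrite in_setI in_box andbC.
  by rewrite (_ : [forall _, _]) //; apply/forallP => j; rewrite in_setT.
rewrite weight_setT prod_nat_const card_ord => bound.
rewrite card_ffun card_prod card_bool !card_ord.
apply: winners_fraction => //.
apply: leq_trans bound _; rewrite leq_add2l leq_mul2l.
by have := tie_weight_setT J L; rewrite card_ord => ->; rewrite orbT.
Qed.

End FewWinners.

Lemma outputs_within X Ans (A : algorithm X Ans) (o : X -> Ans) m k y :
  (forall j, size (answers A o j) <= m) -> A (answers A o k) = Output y ->
  output_within A o m [::] = Some y.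
Proof.
move=> szm Ak.
(* Induction backwards from the output: at step [k - j] the budget left is [m] minus the number of
   answers received. *)
suff H j : j <= k ->
    output_within A o (m - size (answers A o (k - j))) (answers A o (k - j)) = Some y.
  by have := H k (leqnn k); rewrite subnn subn0.
elim: j => [|j IH] jk.
  by rewrite subn0; case: (m - _) => [|?] /=; rewrite Ak.
have := IH (ltnW jk); rewrite (_ : k - j = (k - j.+1).+1); last by lia.
rewrite /=; set h := answers A o (k - j.+1).
have := szm (k - j.+1).+1; rewrite /= -/h.
case Ah: (A h) => [x|z //]; rewrite size_rcons => hm.
by rewrite (_ : m - size h = (m - (size h).+1).+1) ?/= ?Ah//; lia.
Qed.

From mathcomp Require Import all_classical all_reals all_analysis.
From mathcomp Require Import measurable_realfun lra.

Import numFieldNormedType.Exports.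
Local Open Scope classical_set_scope.
Local Open Scope ring_scope.

(** * Functionals on the unit ball *)

(* Entry [i, j] of the Sylvester-Hadamard matrix of order [2 ^ k] is
   [(-1) ^+ walsh k i j]. *)
Fixpoint walsh k i j : bool :=
  if k is k'.+1 then (odd i && odd j) (+) walsh k' i./2 j./2 else false.

Section WalshMatrix.
Variable T : comPzRingType.

Lemma big_nat_double n (G : nat -> T) :
  \sum_(0 <= j < n.*2) G j = \sum_(0 <= j < n) (G j.*2 + G j.*2.+1).
Proof.
elim: n => [|n IH]; first by rewrite !big_geq.
by rewrite doubleS !big_nat_recr//= IH addrA.
Qed.

(** Pairing columns [2j] and [2j + 1] factors out 2 or 0, according to whether the lowest bits of
    [i] and [i'] agree; induction handles the halves. *)
Lemma walsh_orthogonal k i i' : (i < 2 ^ k)%N -> (i' < 2 ^ k)%N ->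
  \sum_(0 <= j < 2 ^ k) (-1) ^+ walsh k i j * (-1) ^+ walsh k i' j
    = (2 ^ k)%:R *+ (i == i') :> T.
Proof.
elim: k i i' => [|k IH] i i'.
  by rewrite expn0 !ltnS !leqn0 => /eqP-> /eqP->; rewrite big_nat1 !expr0 mulr1.
rewrite !expnS !mul2n -!ltn_half_double => hi hi'.
rewrite big_nat_double.
under eq_bigr => j _.
  rewrite /= doubleK uphalf_double odd_double/= !andbF !andbT/=.
  rewrite !signr_addb mulrACA -[X in X + _]mul1r -mulrDl.
  over.
rewrite -mulr_sumr IH// -[in RHS](odd_double_half i) -[in RHS](odd_double_half i').
case: (odd i); case: (odd i'); rewrite /= ?expr0 ?expr1 ?mulrNN ?mulr1 ?mul1r.
- rewrite !add1n eqSS (inj_eq double_inj).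
  by rewrite mulrnAr -mul2n natrM.
- rewrite subrr mul0r add0n add1n (_ : _ == _ = false)//.
  by apply/negP => /eqP/(congr1 odd); rewrite /= !odd_double.
- rewrite subrr mul0r add0n add1n (_ : _ == _ = false)//.
  by apply/negP => /eqP/(congr1 odd); rewrite /= !odd_double.
- rewrite !add0n (inj_eq double_inj).
  by rewrite mulrnAr -mul2n natrM.
Qed.

End WalshMatrix.

Section PowerMean.
Variable R : realType.

(** Young's inequality for [b * 1] with the exponent [q] and its conjugate. *)
Lemma powR_bernoulli (q b : R) : 1 <= q -> 0 <= b -> 1 + q * (b - 1) <= b `^ q.
Proof.
rewrite le_eqVlt => /predU1P[<- b0|q1 b0].
  by rewrite powRr1// mul1r addrC subrK.
have q0 : 0 < q := lt_trans ltr01 q1.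
have q'0 : 0 < q / (q - 1) by rewrite divr_gt0 ?subr_gt0.
have conj : q^-1 + (q / (q - 1))^-1 = 1.
  by rewrite invf_div -[X in X + _]mul1r -mulrDl addrC subrK divff ?gt_eqF.
have := conjugate_powR b0 ler01 q0 q'0 conj.
rewrite powR1 mul1r mulr1 invf_div.
rewrite -(ler_pM2l q0) mulrDr mulrCA divff ?gt_eqF// mulr1.
by rewrite [q * ((q - 1) / q)]mulrCA divff ?gt_eqF// mulr1; lra.
Qed.

(** Tangent line at the mean [m]: apply [powR_bernoulli] to each [a i / m] and sum; the linear terms
    cancel. *)
Lemma power_mean (I : finType) (P : pred I) (a : I -> R) (q : R) :
  1 <= q -> (0 < #|P|)%N -> (forall i, 0 <= a i) ->
  #|P|%:R * ((\sum_(i | P i) a i) / #|P|%:R) `^ q <= \sum_(i | P i) a i `^ q.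
Proof.
move=> q1 P0 a0; set N : R := #|P|%:R; move mE: (_ / N) => m.
have N0 : 0 < N by rewrite ltr0n.
have q0 : 0 < q by apply: lt_le_trans q1.
have sum0 : 0 <= \sum_(i | P i) a i by rewrite sumr_ge0.
have : 0 <= m by rewrite -mE divr_ge0// ltW.
rewrite le_eqVlt => /predU1P[<-|m0].
  by rewrite powR0 ?gt_eqF// mulr0 sumr_ge0// => i _; rewrite powR_ge0.
have step i : m `^ q * (1 + q * (a i / m - 1)) <= a i `^ q.
  rewrite -[in leRHS](divfK (lt0r_neq0 m0) (a i)) powRM ?divr_ge0 ?(ltW m0)// mulrC.
  by rewrite ler_pM2r ?powR_gt0// powR_bernoulli// divr_ge0// ltW.
apply: le_trans (ler_sum _ (fun i _ => step i)).
rewrite -mulr_sumr big_split/= -mulr_sumr sumrB -mulr_suml.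
rewrite !sumr_const -/N.
have -> : \sum_(i | P i) a i = N * m by rewrite -mE mulrC divfK ?gt_eqF.
by rewrite mulfK ?gt_eqF// subrr mulr0 addr0 mulrC.
Qed.

End PowerMean.

Section SignSystem.
Variables (R : realType) (p : R).
Hypothesis p1 : 1 <= p.
Let p0 : 0 < p. Proof. exact: lt_le_trans p1. Qed.

Definition dotp n (u x : 'rV[R]_n) : R := \sum_(k < n) u 0 k * x 0 k.

Definition sign_system n M (mu : R) (u : 'I_M -> 'rV[R]_n) : Prop :=
  (forall j x, `|dotp (u j) x| <= lpnorm p x) /\
  (forall s : 'I_M -> bool, exists2 x, lpnorm p x <= 1 &
     forall j, (-1) ^+ s j * dotp (u j) x = - mu).

Lemma lpnorm_powR n (x : 'rV[R]_n) :
  lpnorm p x `^ p = \sum_(k < n) `|x 0 k| `^ p.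
Proof.
by rewrite /lpnorm -powRrM mulVf ?gt_eqF// powRr1// sumr_ge0// => k _;
  rewrite powR_ge0.
Qed.

Lemma le_lpnorm n (x : 'rV[R]_n) (b : R) : 0 <= b ->
  (b <= lpnorm p x) = (b `^ p <= \sum_(k < n) `|x 0 k| `^ p).
Proof.
move=> b0; rewrite -lpnorm_powR; apply/idP/idP => h.
  by apply: ge0_ler_powR => //; rewrite ?nnegrE ?powR_ge0 ?ltW.
rewrite leNgt; apply/negP => /(gt0_ltr_powR p0).
by rewrite !nnegrE powR_ge0 b0 ltNge h => /(_ isT isT).
Qed.

Lemma lpnorm_le1 n (x : 'rV[R]_n) :
  \sum_(k < n) `|x 0 k| `^ p <= 1 -> lpnorm p x <= 1.
Proof.
rewrite -lpnorm_powR => h; rewrite leNgt; apply/negP => /(gt0_ltr_powR p0).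
by rewrite !nnegrE powR_ge0 ler01 powR1 ltNge h => /(_ isT isT).
Qed.

Lemma card_ord_lt n N : (N <= n)%N -> #|(fun j : 'I_n => (j < N)%N)| = N.
Proof.
move=> Nn; pose e (j : 'I_N) : 'I_n := widen_ord Nn j.
rewrite -[RHS](card_ord N) -(card_imset predT (f := e)); last first.
  by move=> i j /(congr1 val) /= /val_inj.
apply: eq_card => k; apply/idP/imsetP => [kN|[j _ ->]]; last first.
  by change (j < N)%N.
by exists (Ordinal kN) => //; exact: val_inj.
Qed.

(** A point with [M] entries of modulus [M ^ (- 1 / p)] and zeros elsewhere has norm one. *)
Lemma coordinate_sign_system n M : (0 < M)%N -> (M <= n)%N ->
  exists u, @sign_system n M (M%:R `^ (- p^-1)) u.
Proof.
move=> M0 Mn; pose e (j : 'I_M) : 'I_n := widen_ord Mn j.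
exists (fun j => delta_mx 0 (e j)).
have dotE j x : dotp (delta_mx 0 (e j)) x = x 0 (e j).
  rewrite /dotp (bigD1 (e j))//= !mxE !eqxx mul1r big1 ?addr0// => k kj.
  by rewrite !mxE (negbTE kj) andbF mul0r.
split=> [j x|s].
  by rewrite dotE le_lpnorm// (bigD1 (e j))//= lerDl sumr_ge0.
pose mu : R := M%:R `^ (- p^-1).
pose x : 'rV[R]_n := \row_k
  if insub (k : nat) is Some j then - ((-1) ^+ s j * mu) else 0.
exists x.
  apply: lpnorm_le1.
  rewrite (bigID (fun k : 'I_n => (k < M)%N))/= [X in _ + X]big1 ?addr0; last first.
    by move=> k kM; rewrite mxE insubF ?normr0 ?powR0 ?gt_eqF//; apply/negbTE.
  rewrite (eq_bigr (fun=> M%:R^-1)); last first.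
    move=> k kM; rewrite mxE insubT normrN normrM normr_sign mul1r.
    rewrite ger0_norm ?powR_ge0// -powRrM mulNr mulVf ?gt_eqF//.
    by rewrite powR_inv1.
  rewrite sumr_const -[leLHS]mulr_natl (card_ord_lt Mn).
  by rewrite divff// pnatr_eq0 -lt0n.
move=> j; rewrite dotE mxE insubT//= => jM.
rewrite (_ : Sub _ _ = j); last exact: val_inj.
by rewrite mulrN mulrA -signr_addb addbb mul1r.
Qed.

(** The functionals are rescaled Walsh rows; the point is minus a multiple of their signed sum, from
    which orthogonality extracts each sign. *)
Lemma walsh_sign_system n M k : p <= 2 -> (0 < M)%N -> (M <= 2 ^ k)%N ->
  (2 ^ k <= n)%N -> exists u, @sign_system n M (M%:R `^ (- 2^-1)) u.
Proof.
move=> p2 M0; set N := (2 ^ k)%N => MN Nn.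
have N0 : 0 < N%:R :> R by rewrite ltr0n expn_gt0.
have MR0 : 0 < M%:R :> R by rewrite ltr0n.
pose w (i j : nat) : R := (-1) ^+ walsh k i j.
have orth (i i' : 'I_M) :
    \sum_(j < n | (j < N)%N) w i j * w i' j = N%:R *+ (i == i').
  rewrite -(big_ord_widen n (fun j => w i j * w i' j) Nn).
  rewrite -(big_mkord xpredT (fun j => w i j * w i' j)).
  by rewrite walsh_orthogonal// (leq_trans (ltn_ord _)).
(* [kap] normalizes a row of signs in the dual norm. [al] brings the signed sum [y] into the ball:
   its Euclidean norm is [(N * M) ^ (1 / 2)], so its p-norm is at most [N ^ (1 / p) * M ^ (1 / 2)]
   by the power mean inequality. *)
pose kap : R := N%:R `^ p^-1 / N%:R.
pose al : R := N%:R `^ (- p^-1) * M%:R `^ (- 2^-1).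
have kap0 : 0 <= kap by rewrite divr_ge0 ?powR_ge0 ?ltW.
have al0 : 0 <= al by rewrite mulr_ge0 ?powR_ge0.
exists (fun i => \row_j if (j < N)%N then kap * w i j else 0).
have dotE (i : 'I_M) x : dotp (\row_j if (j < N)%N then kap * w i j else 0) x =
    kap * \sum_(j < n | (j < N)%N) w i j * x 0 j.
  rewrite /dotp mulr_sumr [RHS]big_mkcond/=; apply: eq_bigr => j _.
  by rewrite mxE; case: ifP => _; rewrite ?mul0r ?mulrA.
split=> [i x|s].
  rewrite dotE normrM (ger0_norm kap0).
  pose T : R := \sum_(j < n | (j < N)%N) `|x 0 j|.
  apply: (@le_trans _ _ (kap * T)).
    rewrite ler_wpM2l// (le_trans (ler_norm_sum _ _ _))// ler_sum// => j _.
    by rewrite normrM normr_sign mul1r.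
  have T0 : 0 <= T by rewrite sumr_ge0.
  rewrite le_lpnorm; last by rewrite mulr_ge0.
  rewrite (_ : kap * T = N%:R `^ p^-1 * (T / N%:R)); last first.
    by rewrite /kap mulrAC mulrA.
  rewrite powRM ?powR_ge0// ?divr_ge0 ?(ltW N0)//.
  rewrite -powRrM mulVf ?gt_eqF// powRr1 ?(ltW N0)//.
  have cN : (0 < #|(fun j : 'I_n => (j < N)%N)|)%N.
    by rewrite card_ord_lt// expn_gt0.
  have := power_mean p1 cN (fun j => normr_ge0 (x 0 j)).
  rewrite card_ord_lt// => /le_trans; apply.
  by rewrite [leRHS](bigID (fun j : 'I_n => (j < N)%N))/= lerDl sumr_ge0.
pose y (j : nat) : R := \sum_(i < M) (-1) ^+ s i * w i j.
exists (\row_j if (j < N)%N then - (al * y j) else 0).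
  apply: lpnorm_le1.
  rewrite (bigID (fun j : 'I_n => (j < N)%N))/= [X in _ + X]big1 ?addr0; last first.
    by move=> j /negbTE jN; rewrite mxE jN normr0 powR0 ?gt_eqF.
  rewrite (eq_bigr (fun j : 'I_n => al `^ p * `|y j| `^ p)); last first.
    by move=> j jN; rewrite mxE jN normrN normrM (ger0_norm al0) powRM.
  rewrite -mulr_sumr.
  have q1 : 1 <= 2 / p by rewrite ler_pdivlMr// mul1r.
  have cN : (0 < #|(fun j : 'I_n => (j < N)%N)|)%N.
    by rewrite card_ord_lt// expn_gt0.
  have := power_mean q1 cN (fun j => powR_ge0 `|y j| p).
  rewrite card_ord_lt//.
  set T := \sum_(j < n | _) _ `^ p.
  have T0 : 0 <= T by rewrite sumr_ge0// => j _; rewrite powR_ge0.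
  have -> : \sum_(j < n | (j < N)%N) (`|y j| `^ p) `^ (2 / p) = N%:R * M%:R.
    rewrite (eq_bigr (fun j : 'I_n => \sum_(i < M) \sum_(i' < M)
       (-1) ^+ s i * (-1) ^+ s i' * (w i j * w i' j))); last first.
      move=> j _; rewrite -powRrM mulrCA divff ?gt_eqF// mulr1.
      rewrite powR_mulrn// -normrX ger0_norm ?sqr_ge0// expr2 mulr_suml.
      apply: eq_bigr => i _; rewrite mulr_sumr; apply: eq_bigr => i' _.
      by rewrite mulrACA.
    rewrite exchange_big/= (eq_bigr (fun=> N%:R)).
      by rewrite sumr_const card_ord mulr_natr.
    move=> i _; rewrite exchange_big/= (bigD1 i)//= -mulr_sumr orth eqxx.
    rewrite -signr_addb addbb mul1r big1 ?addr0// => i' ii'.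
    by rewrite -mulr_sumr orth eq_sym (negbTE ii') mulr0.
  rewrite ler_pM2l// => /(ge0_ler_powR (ltW (_ : 0 < p / 2))).
  rewrite !nnegrE powR_ge0 (ltW MR0) => /(_ _ isT isT).
  rewrite -powRrM (_ : 2 / p * (p / 2) = 1); last first.
    by rewrite mulrA divfK ?gt_eqF// divff// pnatr_eq0.
  rewrite powRr1; last by rewrite divr_ge0// ltW.
  rewrite ler_pdivrMr// => h.
  apply: (le_trans (ler_wpM2l (powR_ge0 _ _) (h _))); first by rewrite divr_gt0.
  have -> : al `^ p = N%:R^-1 * (M%:R `^ (p / 2))^-1.
    rewrite /al powRM ?powR_ge0// -!powRrM mulNr mulVf ?gt_eqF//.
    by rewrite powR_inv1 ?(ltW N0)// mulNr [_ * p]mulrC powRN.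
  rewrite -invfM [_ * N%:R]mulrC mulVf// mulf_neq0 ?lt0r_neq0//.
  exact: powR_gt0.
move=> i; rewrite dotE.
have -> : \sum_(j < n | (j < N)%N) w i j *
    (\row_j0 (if (j0 < N)%N then - (al * y j0) else 0)) 0 j =
    - (al * ((-1) ^+ s i * N%:R)).
  rewrite (eq_bigr (fun j : 'I_n => - al *
      \sum_(i' < M) (-1) ^+ s i' * (w i j * w i' j))); last first.
    move=> j jN; rewrite mxE jN mulrN mulNr; congr (- _).
    rewrite mulrCA; congr (_ * _); rewrite mulr_sumr.
    by apply: eq_bigr => i' _; rewrite mulrCA.
  rewrite -mulr_sumr exchange_big/= mulNr; congr (- (_ * _)).
  rewrite (bigD1 i)//= -mulr_sumr orth eqxx big1 ?addr0// => i' ii'.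
  by rewrite -mulr_sumr orth eq_sym (negbTE ii') mulr0.
rewrite !mulrN; congr (- _).
have : (-1) ^+ s i * (-1) ^+ s i = 1 :> R by rewrite -signr_addb addbb.
move: ((-1) ^+ s i) => e ee.
transitivity (e * e * (kap * al * N%:R)); first by ring.
rewrite ee mul1r /kap /al powRN.
have : N%:R `^ p^-1 != 0 :> R by rewrite lt0r_neq0// powR_gt0.
move: (lt0r_neq0 N0); move: (N%:R `^ p^-1) (M%:R `^ _) (N%:R) => b m d d0 b0.
by field; rewrite b0 d0.
Qed.

End SignSystem.

Lemma exists_sign_system (R : realType) (p : R) n M : 1 <= p ->
  (0 < M)%N -> (2 * M <= n)%N ->
  exists u, @sign_system R p n M (M%:R `^ (- (Num.max p 2)^-1)) u.
Proof.
move=> p1 M0 Mn; have [p2|p2] := leP p 2; last first.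
  by apply: coordinate_sign_system => //; lia.
have n0 : (0 < n)%N by lia.
(* The largest power of two up to [n] exceeds [n / 2], hence is at least [M]. *)
have /andP[kn nk] := trunc_log_bounds (isT : (1 < 2)%N) n0.
apply: (walsh_sign_system p1 p2 M0 _ kn); rewrite expnS in nk; lia.
Qed.

(** * The hard instances and their uniform distribution *)

Section HardInstances.
Variables (R : realType) (p : R) (n M L : nat) (u : 'I_M -> 'rV[R]_n).
Variables (eps : R) (j0 : 'I_M).
Hypothesis u_le : forall j x, `|dotp (u j) x| <= lpnorm p x.
Notation S := (bool * 'I_L)%type.
Implicit Types (th : {ffun 'I_M -> S}) (x y : lpball p n).

(** The shifts are multiples of [eps / L] below [eps]: distinct shifts separate pieces of equal
    sign, yet none is large enough to hide a sign at an [eps]-minimum. *)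
Definition piece (x : 'rV[R]_n) (j : 'I_M) (c : S) : R :=
  (-1) ^+ c.1 * dotp (u j) x - eps * (c.2)%:R / L%:R.

Definition max_piece (th : {ffun 'I_M -> S}) (x : lpball p n) : R :=
  \big[Num.max/piece (val x) j0 (th j0)]_j piece (val x) j (th j).

Lemma piece_le_max th x j : piece (val x) j (th j) <= max_piece th x.
Proof. exact: (le_bigmax _ (fun j => piece (val x) j (th j))). Qed.

Lemma max_piece_le th x b :
  (forall j, piece (val x) j (th j) <= b) -> max_piece th x <= b.
Proof. by move=> h; apply: bigmax_le. Qed.

Lemma dotp_lin (v x y : 'rV[R]_n) a b :
  dotp v (a *: x + b *: y) = a * dotp v x + b * dotp v y.
Proof.
rewrite /dotp !mulr_sumr -big_split; apply: eq_bigr => k _ /=.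
by rewrite !mxE mulrDr !(mulrCA (v 0 k)).
Qed.

Lemma dotpB (v x y : 'rV[R]_n) : dotp v (x - y) = dotp v x - dotp v y.
Proof. by have := dotp_lin v x y 1 (-1); rewrite !scale1r scaleN1r mul1r mulN1r. Qed.

Lemma max_piece_convex th : @convex_on_ball R p n (max_piece th).
Proof.
move=> t x y z /andP[t0 t1] zE; apply: max_piece_le => j.
have t1' : 0 <= 1 - t by rewrite subr_ge0.
apply: le_trans (lerD (ler_wpM2l t0 (piece_le_max th x j))
  (ler_wpM2l t1' (piece_le_max th y j))).
rewrite /piece zE dotp_lin; set e := (-1) ^+ _.
by rewrite le_eqVlt; apply/orP; left; apply/eqP; ring.
Qed.

Lemma max_piece_lipschitz th : @lipschitz1_on_ball R p n (max_piece th).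
Proof.
have half (x y : lpball p n) (b : R) :
    (forall j, `|dotp (u j) (val x - val y)| <= b) ->
    max_piece th x - max_piece th y <= b.
  move=> hb; rewrite lerBlDr; apply: max_piece_le => j.
  apply: le_trans (lerD (hb j) (piece_le_max th y j)).
  rewrite /piece addrA lerD2r -lerBlDr -mulrBr -dotpB.
  by rewrite (le_trans (ler_norm _))// normrM normr_sign mul1r.
move=> x y; rewrite ler_norml lerNl opprB !half// => j.
by rewrite dotpB distrC -dotpB.
Qed.

Definition hard_instance th : lipschitz_convex p n :=
  LipschitzConvex (max_piece_convex th) (max_piece_lipschitz th).

Lemma cvg_piece T (F : set_system T) (FF : Filter F) (f : T -> 'rV[R]_n)
    (a : 'rV[R]_n) j c :
  (forall k, f y 0 k @[y --> F] --> a 0 k) ->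
  piece (f y) j c @[y --> F] --> piece a j c.
Proof.
move=> fa; rewrite /piece; apply: cvgB; last exact: cvg_cst.
apply: cvgM; first exact: cvg_cst.
rewrite /dotp; elim: (index_enum _) => [|k s IH].
  by rewrite big_nil; under eq_cvg do rewrite big_nil; exact: cvg_cst.
rewrite big_cons; under eq_cvg do rewrite big_cons.
by apply: cvgD => //; apply: cvgM; [exact: cvg_cst | exact: fa].
Qed.

Lemma piece_continuous j c :
  continuous (fun x : lpball p n => piece (val x) j c).
Proof.
move=> x; apply: (@cvg_piece _ (nbhs x) (nbhs_filter x)) => k.
apply: (cvg_comp (fun y : lpball p n => val y)) (@coord_continuous R 1 n 0 k _).
exact: (@initial_continuous (lpball p n) 'rV[R]_n set_val).
Qed.

(** By continuity finitely many strict inequalities persist near [x]; there both maxima are attained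
    among the shared pieces. *)
Lemma max_piece_near (th th' : {ffun 'I_M -> S}) (x : lpball p n) i :
  th i = th' i ->
  (forall j, th j = th' j \/
     piece (val x) j (th j) < piece (val x) i (th i) /\
     piece (val x) j (th' j) < piece (val x) i (th i)) ->
  \forall y \near x, hard_instance th y = hard_instance th' y.
Proof.
move=> thi h.
have near_lt j c : piece (val x) j c < piece (val x) i (th i) ->
    \forall y \near x, piece (val y) j c < piece (val y) i (th i).
  rewrite -subr_gt0 => lt.
  have cv := @cvgB _ _ _ (nbhs x) (nbhs_filter x) _ _ _ _
    (@piece_continuous i (th i) x) (@piece_continuous j c x).
  have := @cvgr_gt _ _ (nbhs x) (nbhs_filter x) _ _ cv 0 lt.
  by apply: filterS => y; rewrite subr_gt0.
have near_all : \forall y \near x, forall j, th j = th' j \/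
     piece (val y) j (th j) < piece (val y) i (th i) /\
     piece (val y) j (th' j) < piece (val y) i (th i).
  apply: (@filter_forall _ _ _ (nbhs x) (nbhs_filter x)) => j.
  have [e|[l1 l2]] := h j; first by apply: nearW => y; left.
  have := @filterI _ (nbhs x) (nbhs_filter x) _ _ (near_lt _ _ l1) (near_lt _ _ l2).
  by apply: filterS => y [? ?]; right.
apply: filterS near_all => y hy /=.
apply/eqP; rewrite eq_le; apply/andP; split; apply: max_piece_le => j.
  have [->|[l1 _]] := hy j; first exact: piece_le_max.
  by rewrite (le_trans (ltW l1))// thi piece_le_max.
have [<-|[_ l2]] := hy j; first exact: piece_le_max.
by rewrite (le_trans (ltW l2))// piece_le_max.
Qed.

Lemma piece_inj (x : 'rV[R]_n) j (d d' : S) : 0 < eps ->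
  d.1 = d'.1 -> piece x j d = piece x j d' -> d = d'.
Proof.
case: d d' => b k [b' k'] /= eps0 <- /addrI/oppr_inj.
have L0 : L%:R != 0 :> R by rewrite pnatr_eq0; case: L k => // -[].
move=> /(mulIf (invr_neq0 L0))/(mulfI (lt0r_neq0 eps0))/eqP.
by rewrite eqr_nat => /eqP kk'; congr (_, _); exact: val_inj.
Qed.

(* An [eps]-minimum makes every signed functional negative, so it reveals all
   the signs. *)
Lemma eps_minimum_sign mu (y : lpball p n) : 0 < eps -> 2 * eps <= mu ->
  (forall s : 'I_M -> bool, exists2 x, lpnorm p x <= 1 &
     forall j, (-1) ^+ s j * dotp (u j) x = - mu) ->
  exists b : 'I_M -> bool, forall th,
    eps_minimum (hard_instance th) eps y -> forall j, (th j).1 = b j.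
Proof.
(* [true] encodes the sign -1, so a negative signed value has [dotp] positive exactly for [true]. *)
move=> eps0 epsmu hs; exists (fun j => 0 < dotp (u j) (val y)).
move=> th [x0 x0min yx0] j.
have [x x1 hx] := hs (fun j => (th j).1).
have shift0 (c : S) : 0 <= eps * (c.2)%:R / L%:R.
  by rewrite divr_ge0// mulr_ge0// ltW.
have shift1 (c : S) : eps * (c.2)%:R / L%:R <= eps.
  have L0 : 0 < L%:R :> R by rewrite ltr0n; case: c => _ [k /=]; lia.
  by rewrite ler_pdivrMr// ler_pM2l// ler_nat ltnW// ltn_ord.
have fx0 : max_piece th x0 <= - mu.
  apply: le_trans (x0min (SigSub (mem_set (x1 : lpball p n x)))) _.
  by apply: max_piece_le => k; rewrite /piece /= hx lerBlDr lerDl.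
(* At [y] each piece is below [- mu + eps], and undoing the shift adds at most [eps]; hence the
   condition [2 * eps <= mu]. *)
have := le_lt_trans (piece_le_max th y j) yx0; rewrite /= /piece.
have := shift1 (th j); move: fx0; case: (th j).1; rewrite ?expr1 ?expr0 ?mulN1r ?mul1r.
  by move=> ? ? ?; apply/esym; lra.
by move=> ? ? ?; apply/esym/negbTE; rewrite -leNgt; lra.
Qed.

End HardInstances.

(** * Uniform laws and averages over the seed *)

Section UniformLaw.
Context d (T : measurableType d) (R : realType).
Variables (I : finType) (i0 : I) (f : I -> T).
Local Open Scope ereal_scope.

Lemma uniform_weight_ge0 : (0 <= #|I|%:R^-1 :> R)%R.
Proof. by rewrite invr_ge0. Qed.

(** The image under [f] of the uniform law on [I]; [msum] is indexed by naturals, hence the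
    enumeration. *)
Definition uniform_law : set T -> \bar R :=
  msum (fun k => mscale (NngNum uniform_weight_ge0) \d_(f (nth i0 (enum I) k))) #|I|.

HB.instance Definition _ := Measure.on uniform_law.

Let sum_enum (g : I -> \bar R) :
  \sum_(k < #|I|) g (nth i0 (enum I) k) = \sum_i g i.
Proof.
rewrite -(big_mkord xpredT (fun k => g (nth i0 (enum I) k))) cardE.
by rewrite -(big_nth i0 xpredT g) big_enum.
Qed.

Lemma integral_uniform_law (g : T -> \bar R) : (forall x, 0 <= g x) ->
  measurable_fun [set: T] g ->
  \int[uniform_law]_x g x = (#|I|%:R^-1)%:E * \sum_i g (f i).
Proof.
move=> g0 mg; rewrite ge0_integral_measure_sum//=.
rewrite -sum_enum ge0_sume_distrr//; apply: eq_bigr => k _.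
by rewrite ge0_integral_mscale//= integral_dirac//= diracT mul1e.
Qed.

Lemma uniform_law_setT : uniform_law [set: T] = 1.
Proof.
rewrite -[LHS]mul1e -integral_cst// integral_uniform_law//.
rewrite sumEFin -EFinM sumr_const mulVf// pnatr_eq0 -lt0n.
by apply/card_gt0P; exists i0.
Qed.

HB.instance Definition _ :=
  @Measure_isProbability.Build _ _ R uniform_law uniform_law_setT.

End UniformLaw.

Section Averages.
Context d (W : measurableType d) (R : realType) (mu : probability W R).
Local Open Scope ereal_scope.

(** Exchanging sum and integral, a count valid for every [w] bounds the total measure of the
    differences. This carries the bound for deterministic strategies over to randomized ones. *)
Lemma sum_measure_le (I : finType) (S U : I -> set W) (b : R) :
  (forall i, measurable (S i)) -> (forall i, measurable (U i)) ->
  (forall w, \sum_i \1_(S i `\` U i) w <= b)%R ->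
  \sum_i mu (S i) <= \sum_i mu (U i) + b%:E.
Proof.
move=> mS mU hb.
have mD i : measurable (S i `\` U i) by exact: measurableD.
have hD : \sum_i mu (S i `\` U i) <= b%:E.
  rewrite (eq_bigr (fun i => \int[mu]_w (\1_(S i `\` U i) w)%:E)); last first.
    by move=> i _; rewrite integral_indic// setIT.
  rewrite -ge0_integral_sum//; last first.
    by move=> i; apply/measurable_EFinP; exact: measurable_indic.
  apply: (@le_trans _ _ (\int[mu]_w b%:E)).
    apply: ge0_le_integral => //.
    - by move=> w _; apply: sume_ge0 => i _; rewrite lee_fin.
    - apply: emeasurable_sum => i; apply/measurable_EFinP.
      exact: measurable_indic.
    - by move=> w _; rewrite sumEFin lee_fin.
  rewrite integral_cst//. by rewrite [X in _ * X](probability_setT mu) mule1.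
apply: le_trans (leeD2l _ hD); rewrite -big_split/=.
apply: lee_sum => i _; rewrite -measureU//.
  apply: le_measure; rewrite ?inE//; first exact: measurableU.
  by move=> w Sw; have [Uw|Uw] := pselect (U i w); [left|right].
exact: setDIK.
Qed.

Lemma markov_tail (q : W -> \bar R) (tau : R) : (0 <= tau)%R ->
  (forall w, 0 <= q w) -> measurable_fun [set: W] q ->
  tau%:E * mu [set w | tau%:E <= q w] <= \int[mu]_w q w.
Proof.
move=> tau0 q0 mq; set D := [set w | _].
have mD : measurable D.
  by have := emeasurable_fun_c_infty measurableT mq tau%:E; rewrite setTI.
rewrite -integral_cst//.
apply: (@le_trans _ _ (\int[mu]_(w in D) q w)).
  apply: ge0_le_integral => //; first exact: measurable_funTS.
apply: ge0_subset_integral => //.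
Qed.

End Averages.

(** Query counts are integers, so fewer than [tau <= m + 1] queries means at most [m]. *)
Lemma few_queries_within (R : realType) X Ans (A : algorithm X Ans)
    (o : X -> Ans) (m : nat) (tau : R) y :
  tau <= m.+1%:R -> (num_queries R A o < tau%:E)%E -> outputs A o y ->
  output_within A o m [::] = Some y.
Proof.
move=> taum q [k Ak]; apply: (outputs_within (k := k)) => // j.
have sup_ub : ((size (answers A o j))%:R%:E <= num_queries R A o)%E.
  by apply: ereal_sup_ubound; exists j.
have := le_lt_trans sup_ub q; rewrite lte_fin => /lt_le_trans/(_ taum).
by rewrite ltr_nat ltnS.
Qed.

(** * The hard distribution and the lower bounds *)

Section Core.
Variables (R : realType) (p : R) (m n : nat) (eps : R).
Hypotheses (p1 : 1 <= p) (m0 : (0 < m)%N) (mn : (8 * m <= n)%N).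
Hypotheses (eps0 : 0 < eps)
  (eps_le : 2 * eps <= (4 * m)%:R `^ (- (Num.max p 2)^-1)).
Variables (Ans : Type) (O : lipschitz_convex p n -> lpball p n -> Ans).
Hypothesis O_local : local_oracle O.

(** Each seed fixes a deterministic strategy, which succeeds with fewer than [tau] queries on at
    most the fraction [3 / m] of the instances with [4 * m] pieces; the remaining successes need
    [tau] queries. *)
Lemma exists_hard_distribution :
  exists P : probability (lipschitz_convex p n) R,
  forall (A : randomized_algorithm (lpball p n) Ans R) (Pe tau : R),
    measurable_run O eps A -> error_at_most O eps P A Pe -> tau <= m.+1%:R ->
    ((1 - Pe - 3 / m%:R)%:E <= tail_queries O P A tau)%E.
Proof.
have M0 : (0 < 4 * m)%N by rewrite muln_gt0.
have Mn : (2 * (4 * m) <= n)%N by rewrite mulnA.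
have [u [u_le u_sign]] := exists_sign_system p1 M0 Mn.
pose L := (4 * m ^ 3)%N.
have L0 : (0 < L)%N by rewrite muln_gt0/= expn_gt0 m0.
pose j0 := Ordinal M0.
pose I := {ffun 'I_(4 * m) -> bool * 'I_L}.
pose th0 : I := [ffun=> (true, Ordinal L0)].
pose F (th : I) : lipschitz_convex p n := hard_instance eps j0 u_le th.
pose P := uniform_law R th0 F.
exists P => A Pe tau mrun err taum.
pose S (th : I) := success O eps (A := A) (F th).
pose U (th : I) := [set w : seed A | (tau%:E <= run_queries O (F th) w)%E].
have mS th : measurable (S th) by have [] := mrun (F th).
have mU th : measurable (U th).
  have [mq _] := mrun (F th).
  by have := emeasurable_fun_c_infty measurableT mq tau%:E; rewrite setTI.
have count w : \sum_(th : I) \1_(S th `\` U th) w <= 3 * #|I|%:R / m%:R :> R.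
  pose win th y := `[< eps_minimum (F th) eps y >].
  have phi_inj (x : lpball p n) j (d d' : bool * 'I_L) : d.1 = d'.1 ->
      piece u eps (val x) j d = piece u eps (val x) j d' -> d = d'.
    exact: piece_inj.
  have o_local (th th' : I) (x : lpball p n) i : th i = th' i ->
      (forall j, th j = th' j \/
        (piece u eps (val x) j (th j) < piece u eps (val x) i (th i))%O /\
        (piece u eps (val x) j (th' j) < piece u eps (val x) i (th i))%O) ->
      O (F th) x = O (F th') x.
    by move=> thi h; apply: O_local; exact: max_piece_near thi h.
  have win_sign y : exists b : 'I_(4 * m) -> bool,
      forall th, win th y -> forall j, (th j).1 = b j.
    have [b hb] := eps_minimum_sign L j0 u_le y eps0 eps_le u_sign.
    by exists b => th /asboolP; exact: hb.
  have := few_winners m0 (erefl L) phi_inj o_local win_sign (strategy w).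
  set N := finset _ => fraction.
  rewrite ler_pdivlMr ?ltr0n// -natrM mulrC.
  apply: (@le_trans _ _ (m * #|N|)%:R); last by rewrite ler_nat.
  rewrite natrM ler_wpM2l// -sum1_card natr_sum [leRHS]big_mkcond/=.
  apply: ler_sum => th _; rewrite indicE; case: ifPn => [_|thN].
    by rewrite ler_nat leq_b1.
  rewrite (_ : _ \in _ = false)//; apply/negbTE/negP; rewrite inE => -[Sw Uw].
  case: Sw => y outy miny; move/negP: thN; apply; rewrite finset.inE.
  rewrite (few_queries_within taum _ outy); first by apply/asboolP.
  by rewrite ltNge; apply/negP.
have key := sum_measure_le (seed_law A) mS mU count.
have mT (g : lipschitz_convex p n -> \bar R) : measurable_fun [set: lipschitz_convex p n] g.
  by move=> _ Y _.
move: err; rewrite /error_at_most /tail_queries.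
rewrite !integral_uniform_law// => err.
have cI : #|I|%:R != 0 :> R.
  by rewrite pnatr_eq0 -lt0n; apply/card_gt0P; exists th0.
rewrite EFinB leeBlDr//; apply: le_trans err _.
apply: le_trans (lee_wpmul2l _ key) _; first by rewrite lee_fin invr_ge0.
rewrite ge0_muleDr ?sume_ge0// ?lee_fin ?divr_ge0 ?mulr_ge0// -EFinM.
by rewrite -mulrA mulrCA [_%:R^-1 * _]mulKf.
Qed.

End Core.

Theorem mainTheorem6 (R : realType) (p : R) (hp : 1 <= p) :
  let r := Num.max p 2 in
  (exists2 c : R, 0 < c &
     forall Pe : R, 0 <= Pe < 1 ->
     exists K : R,
     forall (n : nat) (eps : R), (0 < n)%N -> n%:R `^ (- r^-1) <= eps ->
       K <= 1 / eps `^ r ->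
     forall (Ans : Type) (O : lipschitz_convex p n -> lpball p n -> Ans),
       local_oracle O ->
     exists P : probability (lipschitz_convex p n) R,
     forall A : randomized_algorithm (lpball p n) Ans R,
       measurable_run O eps A -> error_at_most O eps P A Pe ->
       ((c * (1 - Pe) / eps `^ r)%:E <= mean_queries O P A)%E)
  /\
  (exists2 c : R, 0 < c &
     forall Pe : R, 0 <= Pe < 1 ->
     exists2 delta : R -> R, delta t @[t --> +oo] --> 0 &
     forall (n : nat) (eps : R), (0 < n)%N -> n%:R `^ (- r^-1) <= eps ->
     forall (Ans : Type) (O : lipschitz_convex p n -> lpball p n -> Ans),
       local_oracle O ->
     exists P : probability (lipschitz_convex p n) R,
     forall A : randomized_algorithm (lpball p n) Ans R,
       measurable_run O eps A -> error_at_most O eps P A Pe ->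
       ((1 - Pe - delta (1 / eps `^ r))%:E <=
          tail_queries O P A (c / eps `^ r))%E).
Proof.
pose r := Num.max p 2.
have r0 : 0 < r by rewrite lt_max ltr0n orbT.
(* For [m] the integer part of [c / eps ^ r], [c <= 1 / 8] and [1 / eps ^ r <= n] give [8 * m <= n],
   while the factor [2 ^ (- r)] gives [4 * m <= (2 * eps) ^ (- r)]. *)
pose c : R := 2 `^ (- r) / 8.
have c0 : 0 < c by rewrite divr_gt0// powR_gt0.
have c8 : 8 * c <= 1.
  rewrite /c mulrC divfK// powRN invf_le1 ?powR_gt0//.
  by rewrite -[leLHS](powRr0 2); apply: ler_powR; [rewrite ler1n | exact: ltW].
(* The bound is vacuous when [c / eps `^ r < 1]. *)
have tail_bound (n : nat) (eps : R) : (0 < n)%N -> n%:R `^ (- r^-1) <= eps ->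
    forall (Ans : Type) (O : lipschitz_convex p n -> lpball p n -> Ans),
    local_oracle O ->
    exists P : probability (lipschitz_convex p n) R,
    forall (A : randomized_algorithm (lpball p n) Ans R) (Pe : R), 0 <= Pe ->
      measurable_run O eps A -> error_at_most O eps P A Pe ->
      ((1 - Pe - 6 / c * (1 / eps `^ r)^-1)%:E
         <= tail_queries O P A (c / eps `^ r))%E.
  move=> n0 neps Ans O Oloc.
  have eps0 : 0 < eps by apply: lt_le_trans neps; rewrite powR_gt0// ltr0n.
  have t0 : 0 < eps `^ r by rewrite powR_gt0.
  have tail0 P A : (0 <= tail_queries O P A (c / eps `^ r))%E.
    exact: integral_ge0.
  pose m := Num.truncn (c / eps `^ r).
  have /andP[mle ltm] : m%:R <= c / eps `^ r < m.+1%:R.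
    by apply: truncn_itv; rewrite divr_ge0// ltW.
  have [m_eq0|m0] := posnP m.
    exists (@dirac _ _ point R) => A Pe Pe0 _ _; apply: le_trans (tail0 _ _).
    rewrite m_eq0 ltr_pdivrMr// mul1r in ltm.
    have : 1 <= 6 / c * (1 / eps `^ r)^-1.
      by rewrite div1r invrK mulrAC ler_pdivlMr// mul1r; lra.
    by rewrite lee_fin; lra.
  have tn : 1 / eps `^ r <= n%:R.
    rewrite ler_pdivrMr// -ler_pdivrMl ?ltr0n// mulr1.
    have := ge0_ler_powR (ltW r0) (powR_ge0 _ _) (ltW eps0) neps.
    by rewrite -powRrM mulNr mulVf ?gt_eqF// powR_inv1.
  have mn : (8 * m <= n)%N.
    rewrite -(ler_nat R) natrM (le_trans _ tn)//.
    rewrite (le_trans (ler_wpM2l _ mle))// mulrA ler_wpM2r// invr_ge0 ltW//.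
  have eps_le : 2 * eps <= (4 * m)%:R `^ (- r^-1).
    have m4 : (4 * m)%:R <= (2 * eps) `^ (- r).
      rewrite natrM (le_trans (ler_wpM2l _ mle))//.
      rewrite powRM ?(ltW eps0)// [eps `^ (- r)]powRN mulrA ler_pM2r ?invr_gt0//.
      by rewrite /c; have := powR_gt0 (- r) (ltr0n R 2); lra.
    have m4_gt0 : 0 < (4 * m)%:R :> R by rewrite ltr0n muln_gt0.
    have ir0 : 0 <= r^-1 by rewrite invr_ge0 ltW.
    have := ge0_ler_powR ir0 (ltW m4_gt0) (powR_ge0 _ _) m4.
    rewrite -powRrM mulNr mulfV ?gt_eqF// powR_inv1 ?mulr_ge0 ?(ltW eps0)// => h.
    rewrite powRN -[leLHS]invrK lef_pV2 ?posrE ?invr_gt0 ?mulr_gt0//.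
    exact: powR_gt0.
  have [P hP] := exists_hard_distribution hp m0 mn eps0 eps_le Oloc.
  exists P => A Pe Pe0 mrun err; apply: le_trans (hP A Pe _ mrun err (ltW ltm)).
  rewrite lee_fin lerD2l lerN2 div1r invrK ler_pdivrMr ?ltr0n//.
  have -> : 6 / c * eps `^ r * m%:R = 6 * m%:R * eps `^ r / c by ring.
  rewrite ler_pdivlMr//.
  (* [c / eps ^ r < m + 1 <= 2 * m] turns the loss [3 / m] into [6 * eps ^ r / c]. *)
  have : c / eps `^ r <= 2 * m%:R.
    by rewrite (le_trans (ltW ltm))// -natrM ler_nat; lia.
  by rewrite ler_pdivrMr//; lra.
split.
  exists (c / 2); first by rewrite divr_gt0.
  (* This [K] makes the loss at most half of [1 - Pe]; Markov's inequality then yields the constant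
     [c / 2]. *)
  move=> Pe /andP[Pe0 Pe1]; exists (12 / (c * (1 - Pe))).
  move=> n eps n0 neps Keps Ans O Oloc.
  have [P hP] := tail_bound n eps n0 neps Ans O Oloc.
  exists P => A mrun err.
  have eps0 : 0 < eps by apply: lt_le_trans neps; rewrite powR_gt0// ltr0n.
  have t0 : 0 < eps `^ r by rewrite powR_gt0.
  have tail := hP A Pe Pe0 mrun err.
  have mT (g : lipschitz_convex p n -> \bar R) :
      measurable_fun [set: lipschitz_convex p n] g by move=> _ Y _.
  have tau0 : 0 <= c / eps `^ r by rewrite divr_ge0// ltW.
  have q0 f w : (0 <= run_queries O f (A := A) w)%E.
    by apply: ereal_sup_ubound; exists 0%N.
  apply: (@le_trans _ _ ((c / eps `^ r)%:E * tail_queries O P A (c / eps `^ r))%E).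
    apply: le_trans (lee_wpmul2l _ tail); last by rewrite lee_fin.
    rewrite -EFinM lee_fin.
    have Pe1' : 0 < 1 - Pe by rewrite subr_gt0.
    rewrite [leLHS](_ : _ = c / eps `^ r * ((1 - Pe) / 2)); last first.
      by field; rewrite gt_eqF.
    rewrite ler_wpM2l//.
    suff : 6 / c * (1 / eps `^ r)^-1 <= (1 - Pe) / 2 by lra.
    move: Keps; rewrite div1r invrK ler_pdivrMr ?mulr_gt0// => Keps.
    have h : 12 * eps `^ r <= c * (1 - Pe).
      by rewrite mulrC -ler_pdivlMl.
    by rewrite mulrAC ler_pdivrMr//; lra.
  rewrite /tail_queries -ge0_integralZl//.
  apply: ge0_le_integral => //.
  - by move=> f _; rewrite mule_ge0.
  - by move=> f _; apply: markov_tail => //; have [] := mrun f.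
exists c => // Pe /andP[Pe0 Pe1].
exists (fun t => 6 / c * t^-1).
  rewrite -[X in _ --> X](mulr0 (6 / c)); apply: cvgM; first exact: cvg_cst.
  apply/gtr0_cvgV0; last exact: cvg_id.
  exact: nbhs_pinfty_gt.
move=> n eps n0 neps Ans O Oloc.
have [P hP] := tail_bound n eps n0 neps Ans O Oloc.
by exists P => A mrun err; exact: hP.
Qed.
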